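(* Let $K$ be a subfield of $\mathbb{C}$ and let $n\ge 3$ be an integer. Put $N=n$ if $n$ is odd and $N=2n$ if $n$ is even, and let $\zeta\in\mathbb{C}$ be a primitive $N$th root of unity. Let $A=\begin{pmatrix} a&b\\ c&d\end{pmatrix}\in GL(2,K)$ be such that, for some $r\in\mathbb{C}$, $$a+d=r(\zeta+\zeta^{-1})\quad\text{and}\quad ad-bc=r^2 .$$ Let $C\in K$ and let $$F=X+A\circ X+A^2\circ X+\ldots+A^{n-1}\circ X+C\in K(X).$$ Let $f_1\in K[X]$ be a numerator polynomial of $F$. Suppose that $f_1$ is irreducible in $K[X]$ and has degree $n$. For an arbitrary zero $x_1$ of $f_1$ in $\mathbb{C}$, put $x_j=A^{j-1}\circ x_1$ for $j=2,\ldots,n$. Then the numbers $x_1,\ldots,x_n$ are the complex zeros of $f_1$. Further, $K[x_1]$ is a Galois extension of $K$ with Galois group $\langle (x_1x_2\ldots x_n)\rangle$, i.e. the Galois group, regarded as a group of permutations of $x_1,\ldots,x_n$, is the cyclic group generated by the $n$-cycle $x_1\mapsto x_2\mapsto\cdots\mapsto x_n\mapsto x_1$.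
   Context: For a matrix $B=\begin{pmatrix} a&b\\ c&d\end{pmatrix}\in GL(2,K)$ and $z\in\mathbb{C}\smallsetminus K$, put $B\circ z=\frac{az+b}{cz+d}\in\mathbb{C}\smallsetminus K$. Likewise, for $g\in K(X)\smallsetminus K$ (where $K(X)$ is the rational function field), put $B\circ g=\frac{ag+b}{cg+d}\in K(X)\smallsetminus K$. Here $A^j$ denotes the usual matrix power. A numerator polynomial of $F\in K(X)$ is a polynomial $f_1\in K[X]$ such that $F=f_1/f_2$ with $f_1,f_2\in K[X]$ co-prime; it is uniquely determined up to a factor in $K\smallsetminus\{0\}$. *)

(* Defs.v *)
From HB Require Import structures.
From mathcomp Require Import all_boot all_order all_algebra.
From mathcomp Require Import all_fingroup all_field.
From mathcomp Require Import reals complex.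
Set Implicit Arguments. Unset Strict Implicit. Unset Printing Implicit Defensive.
Import GRing.Theory.
Local Open Scope ring_scope.

(* The matrix acts through f, the inclusion of K in the field E; E is either
   the complex numbers or K(X). Division is total (z / 0 = 0), but for B
   invertible and z outside the image of K the denominator is nonzero. *)
Definition moebius (K E : fieldType) (f : K -> E) (B : 'M[K]_2) (z : E) : E :=
  (f (B 0 0) * z + f (B 0 1)) / (f (B 1 0) * z + f (B 1 1)).

Definition ratfun_of_poly (K : fieldType) (p : {poly K}) : {fraction {poly K}} :=
  FracField.tofrac p.

Definition ratfun_const (K : fieldType) (a : K) : {fraction {poly K}} :=
  ratfun_of_poly a%:P.

Definition numerator_poly (K : fieldType) (F : {fraction {poly K}})
    (f1 : {poly K}) : Prop :=
  exists f2 : {poly K},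
    [/\ f2 != 0, coprimep f1 f2 & F = ratfun_of_poly f1 / ratfun_of_poly f2].

(* j identifies the extension L of K, over K, with the subring K[x] of E. *)
Definition is_adjunction (K E : fieldType) (f : K -> E) (x : E)
    (L : fieldExtType K) (j : {rmorphism L -> E}) : Prop :=
  (forall a : K, j a%:A = f a) /\
  (forall z : E, (exists u : L, j u = z) <->
                 (exists q : {poly K}, z = (map_poly f q).[x])).

(* The Galois group of L over K, viewed as a group of permutations of the
   (indices of the) family x via the embedding j, is the permutation group H:
   phi sends g to the permutation s with g (x i) = x (s i). *)
Definition Gal_permutes (K E : fieldType) (L : splittingFieldType K)
    (j : {rmorphism L -> E}) (n : nat) (x : 'I_n -> E) (H : {set 'S_n}) : Prop :=
  exists y : 'I_n -> L, (forall i, j (y i) = x i) /\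
  exists phi : {morphism ('Gal({:L} / 1))%g >-> 'S_n},
    [/\ forall (g : gal_of {:L}) (i : 'I_n),
          g \in ('Gal({:L} / 1))%g -> g (y i) = y (phi g i),
        ('injm phi)%g
      & (phi @* 'Gal({:L} / 1))%g = H].

(* The n-cycle 0 -> 1 -> ... -> n-1 -> 0. *)
Definition ncycle (n : nat) : 'S_n := perm (@ordS_inj n).

(* Main.v *)
Require Import Defs.
From HB Require Import structures.
From mathcomp Require Import all_boot all_order all_algebra.
From mathcomp Require Import all_fingroup all_solvable all_field.
From mathcomp Require Import reals complex.
From mathcomp Require Import ring.
Import GRing.Theory.
Local Open Scope ring_scope.
Set Implicit Arguments.
Unset Strict Implicit.
Unset Printing Implicit Defensive.

(** The eigenvalues of A are r zeta and r / zeta, and their ratio zeta ^ 2 has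
exact order n.  Hence A ^ k is a scalar matrix exactly when n divides k
([is_scalar_expr_dvdn]), so A acts on the points outside K as a transformation
of order n.

Evaluating the identity F = f1 / f2 at a point z outside K turns the terms
A ^ k o X into the points A ^ k o z ([ratfun_value_moebius]), so z is a zero of
f1 exactly when the sum of the A ^ k o z, plus C, vanishes
([numerator_value]).  That sum does not change when z is replaced by A o z: the
terms are only permuted cyclically ([sum_moebius_shift]).  So the zeros of f1
are stable under A ([root_numerator_moebius]).

The zero x1 has degree n >= 3 over K.  A fixed point of a non-scalar matrix
is a zero of a nonzero polynomial of degree at most 2 over K, so
A ^ i o x1 = A ^ j o x1 forces A ^ (j - i) to be scalar, that is, i and j to be
congruent mod n ([moebius_orbit_mod]).  The n distinct points x_k therefore
exhaust the zeros of f1 ([moebius_orbit_roots]).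

All zeros of f1 are rational expressions in x1 over K, so L = K[x1] is the
splitting field of a separable polynomial and is Galois of degree n.  An
automorphism g fixes the entries of A; thus g (x_i) = x_k implies
g (A o x_i) = A o x_k, and the permutation of the x_i induced by g commutes
with the n-cycle.  The centralizer of an n-cycle is the group that it generates
([cent1_ncycle]), so the Galois group embeds in that group, and both have order
n ([Gal_permutes_ncycle]).

Only the injection of K into the larger field matters, so everything is proved
for an arbitrary field morphism f : K -> E ([moebius_orbit_galois]); the
abstract extension L is the stem field of f1, which comes with an embedding in
E. *)

(** * Powers of 2 x 2 matrices *)

Lemma eq_matrix2 (R : nzRingType) (A B : 'M[R]_2) :
  A 0 0 = B 0 0 -> A 0 1 = B 0 1 -> A 1 0 = B 1 0 -> A 1 1 = B 1 1 -> A = B.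
Proof.
move=> h00 h01 h10 h11; apply/matrixP => i j.
have o2 (k : 'I_2) : k = 0 \/ k = 1.
  by case: k => [[|[|//]] lt]; [left | right]; apply: val_inj.
by case: (o2 i) => ->; case: (o2 j) => ->.
Qed.

Lemma mulmx2E (R : nzRingType) (A B : 'M[R]_2) i j :
  (A * B) i j = A i 0 * B 0 j + A i 1 * B 1 j.
Proof.
rewrite mxE !big_ord_recl big_ord0 addr0.
by have -> : lift ord0 ord0 = 1 :> 'I_2 by apply: val_inj.
Qed.

(** For eigenvalues l and m, this is Cayley-Hamilton, (A - m) (A - l) = 0, in
the form that makes A - m an eigenvector of right multiplication by A. *)
Lemma cayley_hamilton2 (R : comNzRingType) (A : 'M[R]_2) (l m : R) :
  A 0 0 + A 1 1 = l + m -> A 0 0 * A 1 1 - A 0 1 * A 1 0 = l * m ->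
  (A - m%:M) * A = l *: (A - m%:M).
Proof.
move=> htr hdet; have {}htr : A 0 0 = l + m - A 1 1 by rewrite -htr addrK.
have {}hdet : A 0 1 * A 1 0 = A 0 0 * A 1 1 - l * m by rewrite -hdet; ring.
by apply: eq_matrix2; rewrite mulmx2E !mxE /= ?mulr1n ?mulr0n; ring: hdet htr.
Qed.

(** The spectral decomposition of A ^ k, multiplied by l - m: since
(l - m) 1 = (A - m) - (A - l), right multiplication by A ^ k scales the two
terms by l ^ k and m ^ k. *)
Lemma expr_split_eigen (R : comNzRingType) (A : 'M[R]_2) (l m : R) (k : nat) :
  A 0 0 + A 1 1 = l + m -> A 0 0 * A 1 1 - A 0 1 * A 1 0 = l * m ->
  (l - m) *: A ^+ k = l ^+ k *: (A - m%:M) - m ^+ k *: (A - l%:M).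
Proof.
move=> htr hdet; have hl := cayley_hamilton2 htr hdet.
have hm : (A - l%:M) * A = m *: (A - l%:M).
  by apply: cayley_hamilton2; rewrite 1?[m + l]addrC 1?[m * l]mulrC.
elim: k => [|k IHk].
  by rewrite !expr0 !scale1r opprB [RHS]addrC addrA subrK scalerBl !scalemx1.
by rewrite !exprSr scalerAl IHk mulrBl -!scalerAl hl hm !scalerA.
Qed.

Lemma is_scalar_mx2P (R : nzRingType) (A : 'M[R]_2) :
  is_scalar_mx A <-> [/\ A 0 1 = 0, A 1 0 = 0 & A 0 0 = A 1 1].
Proof.
split=> [/is_scalar_mxP[a ->] | [h01 h10 h00]]; first by rewrite !mxE.
apply/is_scalar_mxP; exists (A 0 0).
by apply: eq_matrix2; rewrite !mxE ?mulr1n ?mulr0n.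
Qed.

(** By the spectral decomposition, (l - m) A ^ k is (l ^ k - m ^ k) A up to a
scalar matrix.  So if A ^ k is scalar and l ^ k <> m ^ k, then A is scalar, and
its two eigenvalues l and m agree. *)
Lemma is_scalar_expr (K E : fieldType) (f : {rmorphism K -> E})
    (A : 'M[K]_2) (l m : E) (k : nat) :
    f (A 0 0 + A 1 1) = l + m ->
    f (A 0 0 * A 1 1 - A 0 1 * A 1 0) = l * m -> l != m ->
  is_scalar_mx (A ^+ k) = (l ^+ k == m ^+ k).
Proof.
move=> htr hdet ne_lm; have lm0 : l - m != 0 by rewrite subr_eq0.
have htr' : map_mx f A 0 0 + map_mx f A 1 1 = l + m by rewrite !mxE -rmorphD.
have hdet' : map_mx f A 0 0 * map_mx f A 1 1 - map_mx f A 0 1 * map_mx f A 1 0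
   = l * m by rewrite !mxE -!rmorphM -rmorphB.
have := expr_split_eigen k htr' hdet'; rewrite -rmorphXn => /matrixP split_lm.
have h01 : (l - m) * f ((A ^+ k) 0 1) = (l ^+ k - m ^+ k) * f (A 0 1).
  by have := split_lm 0 1; rewrite !mxE /= => ->; rewrite !mulr0n; ring.
have h10 : (l - m) * f ((A ^+ k) 1 0) = (l ^+ k - m ^+ k) * f (A 1 0).
  by have := split_lm 1 0; rewrite !mxE /= => ->; rewrite !mulr0n; ring.
have h00 : (l - m) * f ((A ^+ k) 0 0 - (A ^+ k) 1 1)
         = (l ^+ k - m ^+ k) * f (A 0 0 - A 1 1).
  rewrite !rmorphB mulrBr.
  have := split_lm 0 0; have := split_lm 1 1; rewrite !mxE /= => -> ->.
  by rewrite !mulr1n; ring.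
apply/idP/eqP => [/is_scalar_mx2P[a01 a10 /eqP] | eq_lm].
  rewrite -subr_eq0 => /eqP a00; apply/eqP; rewrite -subr_eq0.
  apply/negPn/negP => lmk0; move: h01 h10 h00.
  rewrite a01 a10 a00 !rmorph0 !mulr0 => /esym/eqP.
  rewrite mulf_eq0 (negPf lmk0) fmorph_eq0 => /eqP b01 /esym/eqP.
  rewrite mulf_eq0 (negPf lmk0) fmorph_eq0 => /eqP b10 /esym/eqP.
  rewrite mulf_eq0 (negPf lmk0) fmorph_eq0 subr_eq0 => /eqP b00.
  (* the discriminant of the characteristic polynomial of a scalar matrix *)
  have /eqP : (l - m) ^+ 2 = 0.
    have -> : (l - m) ^+ 2 = (l + m) ^+ 2 - l * m *+ 4 by ring.
    rewrite -htr -hdet b01 b00 mul0r subr0 -rmorphXn -rmorphMn -rmorphB.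
    by rewrite -[RHS](rmorph0 f); congr (f _); ring.
  by rewrite expf_eq0 /= (negPf lm0).
apply/is_scalar_mx2P; move: h01 h10 h00; rewrite eq_lm subrr !mul0r.
move=> /eqP; rewrite mulf_eq0 (negPf lm0) fmorph_eq0 => /eqP b01.
move=> /eqP; rewrite mulf_eq0 (negPf lm0) fmorph_eq0 => /eqP b10.
by move=> /eqP; rewrite mulf_eq0 (negPf lm0) fmorph_eq0 subr_eq0 => /eqP b00.
Qed.

(** If n is odd, squaring is an automorphism of the n-th roots of unity; if n is
even, it halves the order 2 n. *)
Lemma prim_root_sqr (R : idomainType) (n k : nat) (z : R) :
    (if odd n then n else (2 * n)%N).-primitive_root z ->
  (z ^+ 2 ^+ k == 1) = (n %| k)%N.
Proof.
move=> hz; rewrite -exprM -(prim_order_dvd hz); case: ifP => n_odd.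
  by rewrite Gauss_dvdr // coprimen2.
by rewrite dvdn_pmul2l.
Qed.

Lemma det_mx2 (R : comNzRingType) (A : 'M[R]_2) :
  \det A = A 0 0 * A 1 1 - A 0 1 * A 1 0.
Proof.
rewrite (expand_det_row _ 0) !big_ord_recl big_ord0 addr0.
rewrite /cofactor !det_mx11 !mxE /= expr0 expr1.
have -> : lift 0 0 = 1 :> 'I_2 by apply: val_inj.
have -> : lift 1 0 = 0 :> 'I_2 by apply: val_inj.
by rewrite mul1r mulN1r mulrN.
Qed.

(** The rows of an invertible matrix are independent.  A dependence would be
produced by a pole (s = 0, t = 1) or by a K-rational value t (s = 1) of the
Moebius transformation at a point outside K. *)
Lemma rel_row_unitmx2 (K : fieldType) (A : 'M[K]_2) (s t : K) :
  A \in unitmx -> s * A 0 0 = t * A 1 0 -> s * A 0 1 = t * A 1 1 ->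
  s = 0 /\ t = 0.
Proof.
rewrite unitmxE det_mx2 unitfE => /negPf hdet e0 e1.
split; apply/eqP; rewrite -[_ == 0]orbF -hdet -mulf_eq0; apply/eqP.
  have -> : s * (A 0 0 * A 1 1 - A 0 1 * A 1 0)
          = s * A 0 0 * A 1 1 - s * A 0 1 * A 1 0 by ring.
  by rewrite e0 e1; ring.
have -> : t * (A 0 0 * A 1 1 - A 0 1 * A 1 0)
        = A 0 0 * (t * A 1 1) - A 0 1 * (t * A 1 0) by ring.
by rewrite -e0 -e1; ring.
Qed.

(** The eigenvalues r zeta and r / zeta of A have the ratio zeta ^ 2, which is a
primitive n-th root of unity. *)
Lemma is_scalar_expr_dvdn (K E : fieldType) (f : {rmorphism K -> E}) (n : nat)
    (zeta r : E) (A : 'M[K]_2) :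
    (1 < n)%N -> (if odd n then n else (2 * n)%N).-primitive_root zeta ->
    A \in unitmx -> f (A 0 0 + A 1 1) = r * (zeta + zeta^-1) ->
    f (A 0 0 * A 1 1 - A 0 1 * A 1 0) = r ^+ 2 ->
  forall k, is_scalar_mx (A ^+ k) = (n %| k)%N.
Proof.
move=> n_gt1 hzeta uA htr hdet k.
have zeta0 : zeta != 0.
  apply/eqP => z0; have := prim_expr_order hzeta; rewrite z0 expr0n.
  have /gtn_eqF -> := prim_order_gt0 hzeta.
  by move/eqP; rewrite eq_sym oner_eq0.
have r0 : r != 0.
  apply: contraTneq uA => r0; rewrite unitmxE det_mx2 unitfE negbK.
  by rewrite -(fmorph_eq0 f) hdet r0 expr0n.
have m0 : r / zeta != 0 by rewrite mulf_neq0 ?invr_eq0.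
have eig_ratio : r * zeta = r / zeta * zeta ^+ 2.
  by rewrite -mulrA expr2 mulKf.
have eq_scale (c u : E) : c != 0 -> (c * u == c) = (u == 1).
  by move=> c0; rewrite -[X in _ == X]mulr1 (inj_eq (mulfI c0)).
rewrite (@is_scalar_expr _ _ f _ (r * zeta) (r / zeta)).
- by rewrite eig_ratio exprMn eq_scale ?expf_neq0 // (prim_root_sqr k hzeta).
- by rewrite htr mulrDr.
- by rewrite hdet mulrACA mulfV // mulr1 expr2.
rewrite eig_ratio eq_scale // -[zeta ^+ 2]expr1 (prim_root_sqr 1 hzeta).
by rewrite gtnNdvd.
Qed.

(** * Moebius transformations outside the base field *)

Section Moebius.

Variables (K E : fieldType) (f : {rmorphism K -> E}).
Implicit Types (A B : 'M[K]_2) (z : E).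

Lemma affine_eq0_notin z (a b : K) :
  (forall c, f c != z) -> f a * z + f b = 0 -> a = 0 /\ b = 0.
Proof.
move=> zK /eqP; have [-> | a0] := eqVneq a 0.
  by rewrite rmorph0 mul0r add0r fmorph_eq0 => /eqP.
rewrite addr_eq0 -rmorphN => /eqP ez; case/eqP: (zK (- b / a)).
by rewrite fmorph_div -ez mulrC mulKf // fmorph_eq0.
Qed.

Lemma moebius_den_neq0 A z : A \in unitmx -> (forall a, f a != z) ->
  f (A 1 0) * z + f (A 1 1) != 0.
Proof.
move=> uA zK; apply/eqP => /(affine_eq0_notin zK)[c0 d0].
have [] := @rel_row_unitmx2 _ A 0 1 uA; rewrite ?c0 ?d0 ?mul0r ?mulr0 //.
by move=> _ /eqP; rewrite oner_eq0.
Qed.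

(** With total division, the only denominator that has to be nonzero is that of
the inner transformation: that of the outer one cancels or vanishes on both
sides. *)
Lemma moebius_mul A B z : B \in unitmx -> (forall a, f a != z) ->
  moebius f (A * B) z = moebius f A (moebius f B z).
Proof.
move=> uB zK; have q0 := moebius_den_neq0 uB zK.
rewrite /moebius !mulmx2E !rmorphD !rmorphM.
set q := f (B 1 0) * z + f (B 1 1) in q0 *.
set p := f (B 0 0) * z + f (B 0 1).
have clear_den (u v : E) : u * (p / q) + v = (u * p + v * q) / q.
  by rewrite [RHS]mulrDl (mulfK q0) mulrA.
rewrite !clear_den invf_div mulrA divfK //.
by congr (_ / _); rewrite /p /q; ring.
Qed.

Lemma moebius_notin A z : A \in unitmx -> (forall a, f a != z) ->
  forall a, f a != moebius f A z.
Proof.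
move=> uA zK t; apply/eqP => et; have q0 := moebius_den_neq0 uA zK.
have {}et : f t * (f (A 1 0) * z + f (A 1 1)) = f (A 0 0) * z + f (A 0 1).
  by rewrite et divfK.
have [|h0 h1] := @affine_eq0_notin z (A 0 0 - t * A 1 0) (A 0 1 - t * A 1 1) zK.
  transitivity (f (A 0 0) * z + f (A 0 1)
                - f t * (f (A 1 0) * z + f (A 1 1))); last by rewrite et subrr.
  by rewrite !rmorphB !rmorphM; ring.
have [] := @rel_row_unitmx2 _ A 1 t uA; rewrite ?mul1r.
- by apply/eqP; rewrite -subr_eq0 h0.
- by apply/eqP; rewrite -subr_eq0 h1.
by move=> /eqP; rewrite oner_eq0.
Qed.

Lemma moebius_scalar A z : is_scalar_mx A -> A \in unitmx -> moebius f A z = z.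
Proof.
move/is_scalar_mxP=> [a ->].
rewrite unitmxE det_scalar unitfE expf_eq0 /= => a0.
rewrite /moebius !mxE /= mulr1n mulr0n rmorph0 mul0r addr0 add0r.
by rewrite mulrC mulKf ?fmorph_eq0.
Qed.

Lemma moebius_expr_mod A n k z :
    A \in unitmx -> (forall a, f a != z) -> is_scalar_mx (A ^+ n) ->
  moebius f (A ^+ (k %% n)) z = moebius f (A ^+ k) z.
Proof.
move=> uA zK /is_scalar_mxP[a An].
have An_q q : is_scalar_mx (A ^+ (q * n)).
  by apply/is_scalar_mxP; exists (a ^+ q); rewrite mulnC exprM An -rmorphXn.
rewrite [in RHS](divn_eq k n) addnC exprD moebius_mul ?unitrX //.
by rewrite [moebius _ (A ^+ (_ * n)) z]moebius_scalar ?unitrX.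
Qed.

Lemma horner_map_quad z (a b c : K) :
  (map_poly f (a *: 'X^2 + b *: 'X + c%:P)).[z] = f a * z ^+ 2 + f b * z + f c.
Proof.
rewrite !rmorphD /= !map_polyZ /= map_polyXn map_polyX map_polyC.
by rewrite !hornerE.
Qed.

Lemma high_degree_notin z :
    (forall q : {poly K}, root (map_poly f q) z -> q != 0 -> (3 < size q)%N) ->
  forall a, f a != z.
Proof.
move=> zdeg a; apply/eqP => ez; have := zdeg ('X - a%:P).
rewrite rmorphB /= map_polyX map_polyC root_XsubC polyXsubC_eq0 size_XsubC.
by move/(_ (introT eqP (esym ez)) isT).
Qed.

(** A fixed point z of [[a, b], [c, d]] satisfies c z^2 + (d - a) z - b = 0; as
z has degree at least 3 over K, all three coefficients vanish. *)
Lemma moebius_fixed_scalar A z : A \in unitmx ->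
    (forall q : {poly K}, root (map_poly f q) z -> q != 0 -> (3 < size q)%N) ->
  moebius f A z = z -> is_scalar_mx A.
Proof.
move=> uA zdeg.
have zK := high_degree_notin zdeg.
move=> fixz; have q0 := moebius_den_neq0 uA zK.
have {}fixz : z * (f (A 1 0) * z + f (A 1 1)) = f (A 0 0) * z + f (A 0 1).
  by rewrite -[X in X * _]fixz divfK.
pose q : {poly K} := A 1 0 *: 'X^2 + (A 1 1 - A 0 0) *: 'X + (- A 0 1)%:P.
have qz0 : root (map_poly f q) z.
  rewrite rootE horner_map_quad; apply/eqP.
  transitivity (z * (f (A 1 0) * z + f (A 1 1))
                - (f (A 0 0) * z + f (A 0 1))); last by rewrite fixz subrr.
  by rewrite rmorphB rmorphN; ring.
have /eqP q0' : q == 0.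
  apply/negPn/negP => /(zdeg q qz0); apply/negP; rewrite -leqNgt.
  apply/leq_sizeP => i i2.
  rewrite !(coefD, coefN, coefZ, coefXn, coefX, coefC).
  by case: i i2 => [|[|[|i]]] //= _; rewrite !mulr0 !addr0.
have coefq i : q`_i = 0 by rewrite q0' coef0.
apply/is_scalar_mx2P.
have := coefq 0; have := coefq 1; have := coefq 2.
rewrite !(coefD, coefZ, coefXn, coefX, coefC) /=.
rewrite !(mulr0, mulr1, addr0, add0r) => -> /eqP.
by rewrite subr_eq0 => /eqP -> /eqP; rewrite oppr_eq0 => /eqP ->.
Qed.

(** Multiplying A ^ i and A ^ j by A ^ ((n - 1) i) avoids negative powers:
the first product is A ^ (n i), a scalar matrix. *)
Lemma moebius_orbit_mod (A : 'M[K]_2) (n i j : nat) z :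
    A \in unitmx -> (forall k, is_scalar_mx (A ^+ k) = (n %| k)%N) ->
    (0 < n)%N ->
    (forall q : {poly K}, root (map_poly f q) z -> q != 0 -> (3 < size q)%N) ->
  moebius f (A ^+ i) z = moebius f (A ^+ j) z -> i = j %[mod n].
Proof.
move=> uA scA n_gt0 zdeg; have zK := high_degree_notin zdeg.
have uAk k : A ^+ k \in unitmx by apply: unitrX.
move=> eq_ij; pose k := (n.-1 * i)%N.
have ki : (k + i = n * i)%N by rewrite /k addnC -mulSn prednK.
have : moebius f (A ^+ (k + j)) z = z.
  rewrite exprD moebius_mul // -eq_ij -moebius_mul // -exprD ki.
  by rewrite moebius_scalar // scA dvdn_mulr.
move/(moebius_fixed_scalar (uAk _) zdeg); rewrite scA => n_kj.
by apply/eqP; rewrite -(eqn_modDl k) ki modnMr eq_sym.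
Qed.

End Moebius.

(** Serves both for the embedding of the abstract extension in E and for the
automorphisms of that extension. *)
Lemma rmorph_moebius (K E E' : fieldType) (f : K -> E) (f' : K -> E')
    (g : {rmorphism E -> E'}) (A : 'M[K]_2) z :
  (forall a, g (f a) = f' a) -> g (moebius f A z) = moebius f' A (g z).
Proof. by move=> gf; rewrite /moebius fmorph_div !rmorphD !rmorphM !gf. Qed.

(** * Evaluation of rational functions *)

Lemma ratfun_of_poly1 (K : fieldType) :
  ratfun_of_poly 1 = 1 :> {fraction {poly K}}.
Proof. exact: tofrac1. Qed.

Lemma ratfun_of_polyD (K : fieldType) :
  {morph @ratfun_of_poly K : p q / p + q >-> p + q}.
Proof. exact: tofracD. Qed.

Lemma ratfun_of_polyM (K : fieldType) :
  {morph @ratfun_of_poly K : p q / p * q >-> p * q}.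
Proof. exact: tofracM. Qed.

Lemma ratfun_of_poly_inj (K : fieldType) : injective (@ratfun_of_poly K).
Proof. by move=> p q /eqP; rewrite tofrac_eq => /eqP. Qed.

Lemma ratfun_of_poly_eq0 (K : fieldType) (p : {poly K}) :
  (ratfun_of_poly p == 0) = (p == 0).
Proof. exact: tofrac_eq0. Qed.

Section Evaluation.

Variables (K E : fieldType) (f : {rmorphism K -> E}).

(** F is regular at z with value w.  Any representative p / q whose denominator
does not vanish at z will do, coprime or not, which makes sums easy to
evaluate. *)
Definition ratfun_value (F : {fraction {poly K}}) (z w : E) : Prop :=
  exists p q : {poly K},
    [/\ (map_poly f q).[z] != 0, F * ratfun_of_poly q = ratfun_of_poly p
      & (map_poly f p).[z] = w * (map_poly f q).[z]].

Lemma ratfun_value_const (a : K) z : ratfun_value (ratfun_const a) z (f a).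
Proof.
exists a%:P, 1; split; first by rewrite rmorph1 hornerC oner_eq0.
  by rewrite ratfun_of_poly1 mulr1.
by rewrite rmorph1 map_polyC !hornerC mulr1.
Qed.

Lemma ratfun_value_add F G z v w :
  ratfun_value F z v -> ratfun_value G z w -> ratfun_value (F + G) z (v + w).
Proof.
move=> [p [q [q0 Fq pz]]] [p' [q' [q'0 Gq pz']]].
exists (p * q' + p' * q), (q * q').
rewrite rmorphD !rmorphM hornerD !hornerM /=.
split; first by rewrite mulf_neq0.
  rewrite ratfun_of_polyD !ratfun_of_polyM -Fq -Gq mulrDl mulrA.
  by congr (_ + _); rewrite -mulrA; congr (_ * _); rewrite mulrC.
by rewrite pz pz' /= mulrDl !mulrA; congr (_ + _); rewrite mulrAC.
Qed.

Lemma ratfun_value_sum (n : nat) (F : nat -> {fraction {poly K}})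
    z (w : nat -> E) :
    (forall k, ratfun_value (F k) z (w k)) ->
  ratfun_value (\sum_(0 <= k < n) F k) z (\sum_(0 <= k < n) w k).
Proof.
move=> Fw; elim/big_ind2: _ => // [|? ? ? ?].
  exists 0, 1; split; first by rewrite rmorph1 hornerC oner_eq0.
    by rewrite mul0r /ratfun_of_poly tofrac0.
  by rewrite rmorph0 horner0 mul0r.
exact: ratfun_value_add.
Qed.

Lemma ratfun_value_moebius (A : 'M[K]_2) z :
    A \in unitmx -> (forall a, f a != z) ->
  ratfun_value (moebius (@ratfun_const K) A (ratfun_of_poly 'X)) z
               (moebius f A z).
Proof.
move=> uA zK; have q0 := moebius_den_neq0 uA zK.
have lin_z (a b : K) : (map_poly f (a%:P * 'X + b%:P)).[z] = f a * z + f b.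
  rewrite rmorphD rmorphM /= !map_polyC map_polyX.
  by rewrite !hornerE.
have lin_X (a b : K) : ratfun_of_poly (a%:P * 'X + b%:P)
    = ratfun_const a * ratfun_of_poly 'X + ratfun_const b.
  by rewrite ratfun_of_polyD ratfun_of_polyM.
exists ((A 0 0)%:P * 'X + (A 0 1)%:P), ((A 1 0)%:P * 'X + (A 1 1)%:P).
rewrite !lin_z; split=> //; last by rewrite divfK.
rewrite /moebius -!lin_X divfK // ratfun_of_poly_eq0.
by apply: contraNneq q0 => q0; rewrite -lin_z q0 rmorph0 horner0.
Qed.

(** Comparing the two fractions for F gives f1 (z) = w f2 (z); a zero of f1 is
not a zero of f2, because f1 and f2 are coprime. *)
Lemma numerator_value F f1 z w : numerator_poly F f1 -> ratfun_value F z w ->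
  root (map_poly f f1) z <-> w = 0.
Proof.
move=> [f2 [f2_0 cop defF]] [p [q [q0 Fq pz]]].
have f2F0 : ratfun_of_poly f2 != 0 by rewrite ratfun_of_poly_eq0.
have eq_pq : p * f2 = f1 * q.
  apply: ratfun_of_poly_inj; rewrite !ratfun_of_polyM -Fq defF.
  by rewrite mulrAC divfK.
have eq_z : w * (map_poly f f2).[z] = (map_poly f f1).[z].
  apply: (mulIf q0); rewrite mulrAC -pz -!hornerM -!rmorphM.
  by rewrite eq_pq.
split=> [f1z | w0]; last by rewrite rootE -eq_z w0 mul0r.
have f2z : (map_poly f f2).[z] != 0.
  by apply: coprimep_root f1z; rewrite coprimep_map.
by apply/eqP; move: f1z; rewrite rootE -eq_z mulf_eq0 (negPf f2z) orbF.
Qed.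

(** The terms of the left-hand side are those of index 1, ..., n, and the one of
index n equals the one of index 0. *)
Lemma sum_moebius_shift (A : 'M[K]_2) (n : nat) z :
    A \in unitmx -> (forall a, f a != z) -> is_scalar_mx (A ^+ n) ->
  \sum_(0 <= k < n) moebius f (A ^+ k) (moebius f A z)
  = \sum_(0 <= k < n) moebius f (A ^+ k) z.
Proof.
move=> uA zK An.
rewrite (eq_bigr (fun k => moebius f (A ^+ k.+1) z)); last first.
  by move=> k _; rewrite exprSr moebius_mul.
case: n An => [|n] An; first by rewrite !big_nil.
rewrite big_nat_recr // [RHS]big_nat_recl //= addrC; congr (_ + _).
rewrite moebius_scalar ?unitrX //.
by rewrite expr0 moebius_scalar ?unitmx1 ?scalar_mx_is_scalar.
Qed.

(** Both z and A o z lie outside K, so F can be evaluated at either point, and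
by the cyclic shift the two values agree. *)
Lemma root_numerator_moebius (A : 'M[K]_2) (n : nat) (C : K) F f1 z :
    A \in unitmx -> is_scalar_mx (A ^+ n) ->
    F = \sum_(0 <= k < n)
          moebius (@ratfun_const K) (A ^+ k) (ratfun_of_poly 'X)
        + ratfun_const C ->
    numerator_poly F f1 -> (forall a, f a != z) ->
  root (map_poly f f1) z -> root (map_poly f f1) (moebius f A z).
Proof.
move=> uA An defF num1 zK.
have val_F y : (forall a, f a != y) ->
    ratfun_value F y (\sum_(0 <= k < n) moebius f (A ^+ k) y + f C).
  move=> yK; rewrite defF; apply: ratfun_value_add (ratfun_value_const C y).
  apply: ratfun_value_sum => k; apply: ratfun_value_moebius => //.
  exact: unitrX.
move/(numerator_value num1 (val_F z zK)).1.
rewrite -(sum_moebius_shift uA zK An).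
by apply: (numerator_value num1 (val_F _ (moebius_notin uA zK))).2.
Qed.

End Evaluation.

(** * The centralizer of the n-cycle *)

Lemma ncycleX n k (i : 'I_n) : val ((ncycle n ^+ k)%g i) = ((i + k) %% n)%N.
Proof.
elim: k => [|k IHk]; first by rewrite expg0 perm1 addn0 modn_small.
by rewrite expgSr permM permE /= IHk addnS -addn1 modnDml addn1.
Qed.

Lemma order_ncycle n : (#[ncycle n]%g %| n)%N.
Proof.
rewrite order_dvdn; apply/eqP/permP => i; apply: val_inj.
by rewrite ncycleX perm1 modnDr modn_small.
Qed.

(** A permutation s that commutes with the n-cycle c is determined by s 0,
because c acts transitively; and c ^ (s 0) takes the same value at 0. *)
Lemma cent1_ncycle n (s : 'S_n) :
  commute s (ncycle n) -> s \in <[ncycle n]>%g.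
Proof.
case: n s => [|n] s comm_s.
  by suff -> : s = 1%g by []; apply/permP; case.
apply/cycleP; exists (s ord0 : nat); apply/permP => i.
have def_i : i = (ncycle n.+1 ^+ i)%g ord0.
  by apply: val_inj; rewrite ncycleX add0n modn_small.
rewrite {1}def_i -permM -(commuteX i comm_s) permM.
by apply: val_inj; rewrite !ncycleX addnC.
Qed.

(** * The Galois group of the stem field *)

Section Galois.

Variable K : fieldType.

(** L = K[y], with polynomials over K itself, so that an automorphism passes
through q to y. *)
Definition generates (L : fieldExtType K) (y : L) : Prop :=
  forall u, exists q : {poly K}, u = (map_poly (in_alg L) q).[y].

(** The stem field K[z] of p as an abstract extension: its dimension over K is
that of {poly K} modulo p, and its embedding in E is evaluation at z. *)
Lemma stem_field (E : fieldType) (f : {rmorphism K -> E}) (p : {poly K}) z :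
    irreducible_poly p -> root (map_poly f p) z ->
  exists (L : fieldExtType K) (j : {rmorphism L -> E}),
    is_adjunction f z j /\ \dim {:L} = (size p).-1.
Proof.
move=> irr_p pz; have p0 : p != 0 by apply: irredp_neq0.
exists (SubFieldExtType pz irr_p).
exists (@subfx_inj K E f z p : {rmorphism SubFieldExtType pz irr_p -> E}).
split; last by rewrite dimvf.
split=> [a | w]; first exact: subfx_inj_base.
split=> [[u <-] | [q ->]].
  by have [q ->] := subfxE u; exists q; rewrite -(subfx_inj_eval pz p0).
by exists (subfx_eval f z p q); rewrite -(subfx_inj_eval pz p0).
Qed.

Lemma adjunction_generates (E : fieldType) (f : K -> E) (x : E)
    (L : fieldExtType K) (j : {rmorphism L -> E}) (y : L) :
  is_adjunction f x j -> j y = x -> generates y.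
Proof.
move=> [jK jL] jy u; have [q ju] := (jL (j u)).1 (ex_intro _ u erefl).
exists q; apply: (fmorph_inj j); rewrite -horner_map -map_poly_comp jy ju.
by congr (_.[_]); apply: eq_map_poly => a; rewrite /= jK.
Qed.

Lemma generates_span (L : fieldExtType K) (y : L) (U : {subfield L}) :
  generates y -> y \in U -> (U = fullv :> {vspace L})%VS.
Proof.
move=> gen_y yU; apply/eqP; rewrite eqEsubv subvf; apply/subvP => u _.
have [q ->] := gen_y u; apply: rpred_horner yU.
by apply/polyOverP => i; rewrite coef_map /= memvZ ?mem1v.
Qed.

Lemma splitting_of_roots (L : fieldExtType K) (p : {poly K}) (y : L)
    (rs : seq L) :
    generates y -> y \in rs -> uniq rs -> size p = (size rs).+1 ->
    all (root (map_poly (in_alg L) p)) rs ->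
  splittingFieldFor 1 (map_poly (in_alg L) p) {:L}
  /\ separable_poly (map_poly (in_alg L) p).
Proof.
move=> gen_y y_rs uniq_rs size_p roots_rs.
have p_neq0 : p != 0 by rewrite -size_poly_gt0 size_p.
have eqp_p : map_poly (in_alg L) p %= \prod_(w <- rs) ('X - w%:P).
  rewrite [map_poly _ _](@all_roots_prod_XsubC _ _ rs) ?size_map_poly //;
    last by rewrite uniq_rootsE.
  by rewrite eqp_scale // lead_coef_eq0 map_poly_eq0.
split; last by rewrite (eqp_separable eqp_p) separable_prod_XsubC.
exists rs => //; apply: generates_span gen_y _; exact: seqv_sub_adjoin.
Qed.

(** The equality is one of structures, not merely of carriers, so that an
extension can be replaced by L' in every fact already known about it. *)
Lemma splittingFieldType_of (L : fieldExtType K) :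
    splitting_field_axiom L ->
  exists L' : splittingFieldType K, L = L' :> fieldExtType K.
Proof.
(* once L is in constructor form, the packed L' reduces to it *)
case: L => T c splitL.
set L := FieldExt.Pack _ in splitL *.
pose L' : splittingFieldType K :=
  HB.pack L (FieldExt_isSplittingField.Build K L splitL).
by exists L'.
Qed.

Lemma gal_in_alg (L : splittingFieldType K) (g : gal_of {:L}) (a : K) :
  g (in_alg L a) = in_alg L a.
Proof. by rewrite /= linearZ rmorph1. Qed.

Lemma gal_map_in_alg (L : splittingFieldType K) (g : gal_of {:L})
    (p : {poly K}) :
  map_poly g (map_poly (in_alg L) p) = map_poly (in_alg L) p.
Proof.
by rewrite -map_poly_comp; apply: eq_map_poly => a; apply: gal_in_alg.
Qed.

Lemma gal_root (L : splittingFieldType K) (g : gal_of {:L}) (p : {poly K})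
    (y : L) :
  root (map_poly (in_alg L) p) y -> root (map_poly (in_alg L) p) (g y).
Proof. by move=> py; rewrite -(gal_map_in_alg g) rmorph_root. Qed.

Lemma gal_generator_eq (L : splittingFieldType K) (g h : gal_of {:L}) (y : L) :
  generates y -> g y = h y -> g = h.
Proof.
move=> gen_y eq_gh; apply/eqP/gal_eqP => u _; have [q ->] := gen_y u.
by rewrite -!horner_map /= !gal_map_in_alg eq_gh.
Qed.

(** If an element g of the Galois group sends y_i to y_k, the last hypothesis
makes it send the successor of y_i to the successor of y_k; hence g permutes
the y_i by a permutation commuting with the n-cycle.  As y_i0 generates L, the
permutation determines g, so the image of the Galois group has order
[L : K] = n and fills the cyclic group. *)
Lemma Gal_permutes_ncycle (E : fieldType) (L : splittingFieldType K)
    (j : {rmorphism L -> E}) (n : nat) (x : 'I_n -> E) (y : 'I_n -> L)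
    (i0 : 'I_n) :
    (forall i, j (y i) = x i) -> injective y -> generates (y i0) ->
    galois 1 {:L} -> \dim {:L} = n ->
    (forall (g : gal_of {:L}) i, exists k, g (y i) = y k) ->
    (forall (g : gal_of {:L}) i k,
       g (y i) = y k -> g (y (ordS i)) = y (ordS k)) ->
  Gal_permutes j x <[ncycle n]>%g.
Proof.
move=> yx inj_y gen_y galL dimL stable_y step_y; exists y; split=> //.
have permE_ex (g : gal_of {:L}) : exists s : 'S_n, forall i, g (y i) = y (s i).
  have [s sP] := fin_all_exists (stable_y g).
  have inj_s : injective s.
    by move=> a b eq_s; apply/inj_y/(fmorph_inj g); rewrite [LHS]sP eq_s -sP.
  by exists (perm inj_s) => i; rewrite permE.
(* the default 1 is never taken, by permE_ex *)
pose phi (g : gal_of {:L}) : 'S_n :=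
  odflt 1%g [pick s : 'S_n | [forall i, g (y i) == y (s i)]].
have phiP (g : gal_of {:L}) i : g (y i) = y (phi g i).
  rewrite /phi; case: pickP => [s /forallP/(_ i)/eqP // | no_s].
  have [s sP] := permE_ex g; have /forallP[] := negbT (no_s s).
  by move=> k; rewrite sP.
have phiM : {in 'Gal({:L} / 1)%g &, {morph phi : g h / (g * h)%g}}.
  move=> g h _ _; apply/permP => i; apply: inj_y.
  by rewrite permM -!phiP galM ?memvf // [in RHS]phiP.
pose phi_morph := Morphism phiM.
have inj_phi : ('injm phi_morph)%g.
  apply/injmP => g h _ _ eq_phi; apply: gal_generator_eq gen_y _.
  by rewrite !phiP [phi g]eq_phi.
exists phi_morph; split=> //.
apply/eqP; rewrite eqEcard card_injm // -galois_dim // dimv1 divn1 dimL.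
have n_gt0 : (0 < n)%N := leq_ltn_trans (leq0n i0) (ltn_ord i0).
rewrite -orderE dvdn_leq ?order_ncycle ?andbT //.
apply/subsetP => s /morphimP[g _ _ ->]; apply: cent1_ncycle.
apply/permP => i; apply: inj_y; rewrite !permM ![ncycle n _]permE -[RHS]phiP.
by apply/esym/step_y/phiP.
Qed.

End Galois.

Lemma root_irredp_degree (K E : fieldType) (f : {rmorphism K -> E})
    (p q : {poly K}) (z : E) :
    irreducible_poly p -> root (map_poly f p) z -> root (map_poly f q) z ->
  q != 0 -> (size p <= size q)%N.
Proof.
move=> irr_p pz qz q0; have p0 := irredp_neq0 irr_p.
exact: (subfx_irreducibleP pz p0).2 irr_p q qz q0.
Qed.

(** The orbit consists of n distinct zeros of f1, a polynomial of degree n. *)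
Lemma moebius_orbit_roots (K E : fieldType) (f : {rmorphism K -> E})
    (n : nat) (hn : (3 <= n)%N)
    (zeta : E)
    (hzeta : (if odd n then n else (2 * n)%N).-primitive_root zeta)
    (A : 'M[K]_2) (hA : A \in unitmx)
    (r : E)
    (htr : f (A 0 0 + A 1 1) = r * (zeta + zeta^-1))
    (hdet : f (A 0 0 * A 1 1 - A 0 1 * A 1 0) = r ^+ 2)
    (C : K) (F : {fraction {poly K}})
    (hF : F = \sum_(0 <= k < n)
                moebius (@ratfun_const K) (A ^+ k) (ratfun_of_poly 'X)
              + ratfun_const C)
    (f1 : {poly K}) (hf1 : numerator_poly F f1)
    (hirr : irreducible_poly f1) (hdeg : size f1 = n.+1)
    (x1 : E) (hx1 : root (map_poly f f1) x1)
    (x : 'I_n -> E) (hx : forall k : 'I_n, x k = moebius f (A ^+ k) x1) :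
  injective x /\
  forall z : E, root (map_poly f f1) z <-> exists k : 'I_n, z = x k.
Proof.
have n_gt0 : (0 < n)%N by apply: leq_trans hn.
have scA := is_scalar_expr_dvdn (ltnW hn) hzeta hA htr hdet.
have x1deg (q : {poly K}) : root (map_poly f q) x1 -> q != 0 -> (3 < size q)%N.
  move=> qx q0; apply: leq_trans (root_irredp_degree hirr hx1 qx q0).
  by rewrite hdeg.
have x1K := high_degree_notin x1deg.
have root_x i : root (map_poly f f1) (x i).
  rewrite hx; elim: (i : nat) => [|k IHk].
    by rewrite expr0 moebius_scalar ?unitmx1 ?scalar_mx_is_scalar.
  have uAk : A ^+ k \in unitmx by apply: unitrX.
  rewrite exprS moebius_mul //.
  apply: (root_numerator_moebius hA _ hF hf1) IHk; first by rewrite scA.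
  exact: moebius_notin.
have inj_x : injective x.
  move=> i k; rewrite !hx => /(moebius_orbit_mod hA scA n_gt0 x1deg).
  by rewrite !modn_small // => /val_inj.
have nz_f1 := irredp_neq0 hirr.
have lc0 : lead_coef (map_poly f f1) != 0.
  by rewrite lead_coef_eq0 map_poly_eq0.
have split_f1 : map_poly f f1
    = lead_coef (map_poly f f1) *: \prod_(w <- codom x) ('X - w%:P).
  apply: all_roots_prod_XsubC; last first.
  - by rewrite uniq_rootsE map_inj_uniq ?enum_uniq.
  - by apply/allP => _ /codomP[i ->].
  by rewrite size_map_poly hdeg size_codom card_ord.
split=> // z; split=> [fz | [k ->]]; last exact: root_x.
by apply/codomP; rewrite -root_prod_XsubC -(rootZ _ _ lc0) -split_f1 //.
Qed.

(** The stem field of f1 contains the whole orbit of x1, since the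
transformations A ^ k have coefficients in K; so it is the splitting field of
f1. *)
Theorem moebius_orbit_galois (K E : fieldType) (f : {rmorphism K -> E})
    (n : nat) (hn : (3 <= n)%N)
    (zeta : E)
    (hzeta : (if odd n then n else (2 * n)%N).-primitive_root zeta)
    (A : 'M[K]_2) (hA : A \in unitmx)
    (r : E)
    (htr : f (A 0 0 + A 1 1) = r * (zeta + zeta^-1))
    (hdet : f (A 0 0 * A 1 1 - A 0 1 * A 1 0) = r ^+ 2)
    (C : K) (F : {fraction {poly K}})
    (hF : F = \sum_(0 <= k < n)
                moebius (@ratfun_const K) (A ^+ k) (ratfun_of_poly 'X)
              + ratfun_const C)
    (f1 : {poly K}) (hf1 : numerator_poly F f1)
    (hirr : irreducible_poly f1) (hdeg : size f1 = n.+1)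
    (x1 : E) (hx1 : root (map_poly f f1) x1)
    (x : 'I_n -> E) (hx : forall k : 'I_n, x k = moebius f (A ^+ k) x1) :
  [/\ injective x,
      forall z : E, root (map_poly f f1) z <-> exists k : 'I_n, z = x k
    & exists (L : splittingFieldType K) (j : {rmorphism L -> E}),
        [/\ is_adjunction f x1 j,
            galois 1 {:L}
          & Gal_permutes j x <[ncycle n]>%g]].
Proof.
have [inj_x rootsP] :=
  moebius_orbit_roots hn hzeta hA htr hdet hF hf1 hirr hdeg hx1 hx.
split=> //.
have root_x i : root (map_poly f f1) (x i) by apply/rootsP; exists i.
have n_gt0 : (0 < n)%N by apply: leq_trans hn.
have scA := is_scalar_expr_dvdn (ltnW hn) hzeta hA htr hdet.
have x1deg (q : {poly K}) : root (map_poly f q) x1 -> q != 0 -> (3 < size q)%N.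
  move=> qx q0; apply: leq_trans (root_irredp_degree hirr hx1 qx q0).
  by rewrite hdeg.
have x1K := high_degree_notin x1deg.
have xS i : x (ordS i) = moebius f A (x i).
  (* ordS is the successor mod n, and A ^+ n acts trivially *)
  rewrite !hx moebius_expr_mod // ?scA // exprS moebius_mul //.
  exact: unitrX.
have [L0 [j0 [adj0 dimL0]]] := stem_field hirr hx1.
have [y0 jy0] : exists y0, j0 y0 = x1.
  by apply/(adj0.2 x1).2; exists 'X; rewrite map_polyX hornerX.
have gen_y0 := adjunction_generates adj0 jy0.
pose y (i : 'I_n) := moebius (in_alg L0) (A ^+ i) y0.
have jy i : j0 (y i) = x i.
  by rewrite hx -jy0; apply: rmorph_moebius adj0.1.
have y_0 : y (Ordinal n_gt0) = y0.
  apply: (fmorph_inj j0); rewrite jy hx jy0 expr0.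
  by rewrite moebius_scalar ?unitmx1 ?scalar_mx_is_scalar.
have inj_y : injective y by move=> i k eq_y; apply: inj_x; rewrite -!jy eq_y.
pose f1L := map_poly (in_alg L0) f1.
have root_f1L u : root f1L u = root (map_poly f f1) (j0 u).
  rewrite -(fmorph_root j0) /f1L -map_poly_comp.
  by congr (root _ _); apply: eq_map_poly => a; apply: adj0.1.
have [splits_f1L sep_f1L] :
    splittingFieldFor 1 f1L {:L0} /\ separable_poly f1L.
  apply: (splitting_of_roots (rs := codom y) gen_y0).
  - by rewrite -y_0 codom_f.
  - by rewrite map_inj_uniq ?enum_uniq.
  - by rewrite hdeg size_codom card_ord.
  by apply/allP => _ /codomP[i ->]; rewrite root_f1L jy.
have over_f1L : f1L \is a polyOver 1%VS.
  by apply/polyOverP => i; rewrite coef_map /= memvZ ?mem1v.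
have yS i : y (ordS i) = moebius (in_alg L0) A (y i).
  apply: (fmorph_inj j0); rewrite jy xS -jy.
  by apply/esym/rmorph_moebius/adj0.1.
have [L eqL] : exists L : splittingFieldType K, L0 = L :> fieldExtType K.
  by apply: splittingFieldType_of; exists f1L.
subst L0.
have galL : galois 1 {:L} by apply/splitting_galoisField; exists f1L.
exists L, j0; split=> //.
apply: (@Gal_permutes_ncycle _ _ _ _ _ _ y (Ordinal n_gt0)) => //.
- by rewrite y_0.
- by rewrite dimL0 hdeg.
- move=> g i; have : root f1L (g (y i)) by apply: gal_root; rewrite root_f1L jy.
  rewrite root_f1L => /rootsP[k jg]; exists k.
  by apply: (fmorph_inj j0); apply: etrans jg (esym (jy k)).
move=> g i k gy.
(* g fixes the entries of A *)
rewrite !yS -gy; apply: rmorph_moebius => a; exact: gal_in_alg.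
Qed.

Theorem theorem1 (R : realType) (S : {pred R[i]}) (K : subFieldType S)
    (n : nat) (hn : (3 <= n)%N)
    (zeta : R[i])
    (hzeta : (if odd n then n else (2 * n)%N).-primitive_root zeta)
    (A : 'M[K]_2) (hA : A \in unitmx)
    (r : R[i])
    (htr : \val (A 0 0 + A 1 1) = r * (zeta + zeta^-1))
    (hdet : \val (A 0 0 * A 1 1 - A 0 1 * A 1 0) = r ^+ 2)
    (C : K) (F : {fraction {poly K}})
    (hF : F = \sum_(0 <= k < n)
                moebius (@ratfun_const K) (A ^+ k) (ratfun_of_poly 'X)
              + ratfun_const C)
    (f1 : {poly K}) (hf1 : numerator_poly F f1)
    (hirr : irreducible_poly f1) (hdeg : size f1 = n.+1)
    (x1 : R[i]) (hx1 : root (map_poly \val f1) x1)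
    (x : 'I_n -> R[i]) (hx : forall k : 'I_n, x k = moebius \val (A ^+ k) x1) :
  [/\ injective x,
      forall z : R[i], root (map_poly \val f1) z <-> exists k : 'I_n, z = x k
    & exists (L : splittingFieldType K) (j : {rmorphism L -> R[i]}),
        [/\ is_adjunction \val x1 j,
            galois 1 {:L}
          & Gal_permutes j x <[ncycle n]>%g]].
Proof.
exact: (@moebius_orbit_galois K R[i] \val n hn zeta hzeta A hA r htr hdet C F hF
          f1 hf1 hirr hdeg x1 hx1 x hx).
Qed.
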